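(* Let $X$ be a submetrizable Tychonoff space. Then $$C_{k}(X)=C_{c}(X)=C_{sc}(X)=C_{cc}(X)=C_{ps}(X)=C_{rc}(X),$$ i.e. all these topologies on $C(X)$ coincide.
   Context: A space $X$ is submetrizable if it admits a weaker (coarser) metrizable topology. $C(X)$ is the set of all continuous real-valued functions on $X$. For a family $\lambda$ of non-empty subsets of $X$, the $\lambda$-open topology on $C(X)$ has as subbase all sets $[F,U]=\{f\in C(X): f(F)\subseteq U\}$ with $F\in\lambda$, $U\subseteq\mathbb{R}$ open. A subset $A\subseteq X$ is a $C$-compact subset of $X$ if $f(A)$ is compact in $\mathbb{R}$ for every $f\in C(X)$. $C_k(X)$, $C_c(X)$, $C_{sc}(X)$, $C_{cc}(X)$, $C_{ps}(X)$, $C_{rc}(X)$ denote $C(X)$ with the $\lambda$-open topology where $\lambda$ is the collection of all non-empty subsets of $X$ that are, respectively: metrizable compact; compact; sequentially compact; countably compact; pseudocompact; $C$-compact in $X$. *)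

(* Defs.v *)
From HB Require Import structures.
From mathcomp Require Import all_boot all_order all_algebra.
From mathcomp Require Import all_classical all_reals all_analysis.
Import numFieldNormedType.Exports.

Set Implicit Arguments.
Unset Strict Implicit.
Unset Printing Implicit Defensive.

Local Open Scope classical_set_scope.

(* A metric on [T] is a [Metric R T] structure on the bare carrier of [T]: its
   topology is the metric one, a priori unrelated to that of [T]. *)
Definition metric_open (R : realType) (T : Type) (m : Metric R T) :
  set_system T := @open (Metric.Pack m).

Definition metrizable (R : realType) (T : topologicalType) :=
  exists m : Metric R T, metric_open m = @open T.

Definition submetrizable (R : realType) (T : topologicalType) :=
  exists m : Metric R T, metric_open m `<=` @open T.

(* [completely_regular_space] (library) separates points from closed sets by
   [uniform_separator]; by [uniform_separatorP] this is separation by a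
   continuous function into [0, 1]. It does not include T1. *)
Definition tychonoff_space (T : topologicalType) :=
  completely_regular_space T /\ accessible_space T.

Definition sequentially_compact (T : topologicalType) (A : set T) :=
  forall u : nat -> T, (forall n, A (u n)) ->
    exists2 phi : nat -> nat, increasing_seq phi &
    exists2 x, A x & (u \o phi) @ \oo --> x.

(* [cover_compact] (library) restricted to countable covers. *)
Definition countably_compact (T : topologicalType) (A : set T) :=
  forall (I : choiceType) (D : set I) (f : I -> set T), countable D ->
    (forall i, D i -> open (f i)) -> A `<=` \bigcup_(i in D) f i ->
    finite_subset_cover D f A.

(* The domain [A] of the functions is [set_type A], the subset [A] with its
   subspace topology. *)
Definition pseudocompact (R : realType) (T : topologicalType) (A : set T) :=
  forall f : continuousType A R, bounded_set (range f).

Definition C_compact (R : realType) (T : topologicalType) (A : set T) :=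
  forall f : continuousType T R, compact (f @` A).

(* The coercion of [A] to a type is again its subspace [set_type A]. *)
Definition metrizable_compact (R : realType) (T : topologicalType)
  (A : set T) := compact A /\ metrizable R A.

Definition nonempty_sets (T : Type) (P : set T -> Prop) : set_system T :=
  [set A | A !=set0 /\ P A].

(* C(X) with the lambda-open topology. [continuousType X R] has no global
   topology; this alias carries the one generated by the sets [F, U]. *)
Definition lambda_open (R : realType) (X : topologicalType)
  (lambda : set_system X) : Type := continuousType X R.
Arguments lambda_open R {X} lambda.

Section LambdaOpen.
Variables (R : realType) (X : topologicalType) (lambda : set_system X).

Definition lambda_open_index : set (set X * set R) :=
  [set FU | lambda FU.1 /\ open FU.2].

Definition lambda_open_subbase (FU : set X * set R) :
  set (continuousType X R) := [set f | f @` FU.1 `<=` FU.2].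

HB.instance Definition _ :=
  Choice.copy (lambda_open R lambda) (continuousType X R).
HB.instance Definition _ := isSubBaseTopological.Build (lambda_open R lambda)
  lambda_open_index lambda_open_subbase.

End LambdaOpen.

(* Read on the common carrier, so that topologies for different [lambda] can be
   compared. *)
Definition lambda_topology (R : realType) (X : topologicalType)
  (lambda : set_system X) : set_system (continuousType X R) :=
  @open (lambda_open R lambda).

Section Families.
Variables (R : realType) (X : topologicalType).

Definition Ck := @lambda_topology R X (nonempty_sets (@metrizable_compact R X)).
Definition Cc := @lambda_topology R X (nonempty_sets (@compact X)).
Definition Csc := @lambda_topology R X (nonempty_sets (@sequentially_compact X)).
Definition Ccc := @lambda_topology R X (nonempty_sets (@countably_compact X)).
Definition Cps := @lambda_topology R X (nonempty_sets (@pseudocompact R X)).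
Definition Crc := @lambda_topology R X (nonempty_sets (@C_compact R X)).

End Families.

Arguments Ck : clear implicits.
Arguments Cc : clear implicits.
Arguments Csc : clear implicits.
Arguments Ccc : clear implicits.
Arguments Cps : clear implicits.
Arguments Crc : clear implicits.

(* Main.v *)
From HB Require Import structures.
Require Import Defs.
From mathcomp Require Import all_boot all_order all_algebra.
From mathcomp Require Import all_classical all_reals all_analysis.
Import Order.TTheory GRing.Theory Num.Theory.
Import numFieldNormedType.Exports.

Set Implicit Arguments.
Unset Strict Implicit.
Unset Printing Implicit Defensive.

Local Open Scope classical_set_scope.
Local Open Scope ring_scope.

(** Everything rests on one property of a subset [A] of [X], called
    [positive_gap] below: a continuous function on [X] that is positive on [A]
    is bounded away from 0 on [A].

    Each of the six families consists of sets with this property, in any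
    topological space.  Conversely, let [d] be a continuous metric on the
    Tychonoff space [X], and let [A] have the property.  Three continuous
    functions show that [A] is compact and metrizable:
    - [d x y + |1 - f y|], where [f] separates [x] from the complement of a
      neighborhood [U] of [x], is positive everywhere; its lower bound on [A] is
      the radius of a [d]-ball around [x] whose trace on [A] lies in [U].  So
      [d] induces the topology of [A] ([gap_nbhs_metric]).
    - [inf_n (d x (u n) + 1 / (n + 1))] vanishes exactly at the [d]-cluster
      points of the sequence [u] and takes arbitrarily small values along [u].
      So a sequence of points of [A] clusters in [A] ([gap_cluster_seq]).
    - for an ultrafilter [F] containing [A], the infimum of the radii of the
      balls around [x] that belong to [F] vanishes exactly at the [d]-limits of
      [F].  If [F] has no limit in [A], this function is at least some [e > 0]
      on [A], so that no finite union of balls of radius [e / 2] centered in [A]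
      belongs to [F], and [A] contains an infinite [e / 2]-separated sequence,
      contrary to the previous point ([gap_compact]).

    The other four properties follow from compactness and metrizability.  Hence
    the six families of nonempty sets are the same, and so are the topologies
    they define. *)

(** The functions are defined on the whole space, as for C-compactness: this is
    what makes the property a consequence of each of the six, and the functions
    built from a metric on [X] can be fed to it directly. *)
Definition positive_gap (R : realType) (X : topologicalType) (A : set X) :=
  forall f : X -> R, continuous f -> (forall x, A x -> 0 < f x) ->
  exists2 e, 0 < e & forall x, A x -> e <= f x.

(** * From the compactness properties to the positive gap *)

Section Families_have_gap.
Variables (R : realType) (X : topologicalType) (A : set X).

(** The image of [A] is closed and misses 0, hence misses a neighborhood of 0. *)
Lemma C_compact_gap : C_compact R A -> positive_gap R A.
Proof.
move=> cA f cf f0; have := cA (mkcts cf) => /compact_closed.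
move=> /(_ (@norm_hausdorff _ _)) /closed_openC; rewrite openE /=.
move=> /(_ 0) [|e /= e0 fe].
  by move=> [x /f0 + fx0]; rewrite -fx0 ltxx.
exists e => // x Ax; rewrite leNgt; apply/negP => fxe.
apply: (fe (f x)) => /=; last by exists x.
by rewrite sub0r normrN gtr0_norm// f0.
Qed.

Lemma compact_C_compact : compact A -> C_compact R A.
Proof.
move=> cA f; apply: continuous_compact => //.
exact/continuous_subspaceT/cts_fun.
Qed.

(** A sequence along which [f] tends to 0 would have a limit point in [A] where
    [f] vanishes. *)
Lemma sequentially_compact_gap : sequentially_compact A -> positive_gap R A.
Proof.
move=> sA f cf f0; apply: contrapT => nf.
have /choice[u uP] n : exists x, A x /\ f x < n.+1%:R^-1.
  apply: contrapT => /forallNP nx; apply: nf; exists n.+1%:R^-1 => // x Ax.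
  by rewrite leNgt; apply/negP => fx; exact: (nx x).
have [phi phi_incr [x Ax ux]] := sA u (fun n => (uP n).1).
have phi_ge n : (n <= phi n)%N.
  elim: n => // n; rewrite -ltnS => /leq_trans; apply.
  by move/increasing_seqP : phi_incr; exact.
have fux : f (u (phi n)) @[n --> \oo] --> f x by apply: cvg_comp ux _; exact: cf.
have : f x <= 0.
  apply: (@ler_cvg_to _ \oo _ _ (fun n => f (u (phi n))) harmonic (f x) 0) => //.
    exact: cvg_harmonic.
  near=> n; rewrite (le_trans (ltW (uP _).2))// /harmonic/=.
  by rewrite lef_pV2 ?posrE// ler_nat ltnS.
by rewrite leNgt f0.
Unshelve. all: by end_near. Qed.

(** The open sets [f > 1 / (n + 1)] increase and cover [A]. *)
Lemma countably_compact_gap : countably_compact A -> positive_gap R A.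
Proof.
move=> cA f cf f0.
have [|n _|x Ax|D _ AD] :=
  cA nat setT (fun n => f @^-1` [set r | n.+1%:R^-1 < r]).
- exact: countableP.
- by apply: open_comp => [? _|]; [exact: cf|exact: open_gt].
- have [n fn] := ltr_add_invr (f0 x Ax).
  by exists n => //=; rewrite add0r in fn.
exists (\max_(i <- finmap.enum_fset D) i).+1%:R^-1 => // x.
move=> /AD [n /= nD /ltW]; apply: le_trans.
by rewrite lef_pV2 ?posrE// ler_nat ltnS; exact: leq_bigmax_seq.
Qed.

(** The inverse of [f] is continuous on [A], hence bounded there. *)
Lemma pseudocompact_gap : pseudocompact R A -> positive_gap R A.
Proof.
move=> pA f cf f0.
have cg : continuous (fun x : A => (f (set_val x))^-1).
  move=> x; apply: (@cvgV R A (nbhs x) _ (f \o set_val)).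
    by rewrite gt_eqF// f0//; exact: set_valP.
  by apply: continuous_comp; [exact: initial_continuous|exact: cf].
have [M [_ /(_ (`|M| + 1))]] := pA (mkcts cg).
rewrite (le_lt_trans (ler_norm M)) ?ltrDl// => /(_ isT) fM.
exists (`|M| + 1)^-1 => [|x Ax]; first by rewrite invr_gt0 ltr_wpDl.
have := fM _ (imageT _ (exist _ x (mem_set Ax))); rewrite /= /mkcts set_valE /=.
rewrite gtr0_norm ?invr_gt0 ?f0// => fxM.
by rewrite invf_ple ?posrE ?f0// ltr_wpDl.
Qed.

End Families_have_gap.

(** * The restriction of a metric to a subset *)

(** An alias of the subset [A], on which the restriction of [m] can be declared
    without competing with the subspace topology of [A]. *)
Definition submetric (R : realType) (X : topologicalType) (m : Metric R X)
  (A : set X) : Type := A.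

Section Submetric.
Variables (R : realType) (X : topologicalType) (m : Metric R X) (A : set X).

Let M : metricType R := Metric.Pack m.
Let d (x y : submetric m A) : R := @mdist R M (set_val x) (set_val y).

Let dxx x : d x x = 0. Proof. exact: mdistxx. Qed.

Let d_positivity x y : d x y = 0 -> x = y.
Proof. by move=> /mdist_positivity; exact: val_inj. Qed.

Let d_sym x y : d x y = d y x. Proof. exact: metric_sym. Qed.

Let d_triangle y x z : d x z <= d x y + d y z.
Proof. exact: metric_triangle. Qed.

HB.instance Definition _ := Choice.copy (submetric m A) (set_type A).
HB.instance Definition _ :=
  isMetric.Build R (submetric m A) dxx d_positivity d_sym d_triangle.

End Submetric.

(** * Sets with a positive gap under a coarser metric *)

Section Coarser_metric.
Variables (R : realType) (X : topologicalType) (m : Metric R X).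
Hypothesis mX : metric_open m `<=` @open X.

Let M : metricType R := Metric.Pack m.
Let d (x y : X) : R := @mdist R M x y.

Let d_ge0 x y : 0 <= d x y. Proof. exact: mdist_ge0. Qed.

Let dxx x : d x x = 0. Proof. exact: (@mdistxx _ M). Qed.

Let d_sym x y : d x y = d y x. Proof. exact: (@metric_sym _ M). Qed.

Let d_triangle x y z : d x z <= d x y + d y z.
Proof. exact: (@metric_triangle _ M). Qed.

Lemma coarser_nbhs (x : X) (e : R) : 0 < e -> nbhs x [set y | d x y < e].
Proof.
move=> e0; have : open_nbhs (x : M) (ball (x : M) e)° .
  exact: (@open_nbhs_ball _ M x (PosNum e0)).
move=> [/mX oB Bx]; rewrite nbhsE /=; exists ((ball (x : M) e)°) => //.
by move=> y /interior_subset; rewrite ballEmdist.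
Qed.

Lemma lipschitz_continuous (f : X -> R) :
  (forall x y, f x <= f y + d x y) -> continuous f.
Proof.
move=> fd x; apply/cvgrPdist_lt => e e0.
apply: filterS (coarser_nbhs x e0) => y /= dxy.
rewrite (le_lt_trans _ dxy)// ler_norml lerNl opprB !lerBlDl fd.
by rewrite [d x y]d_sym fd.
Qed.

Lemma mdist_continuous x : continuous (d x).
Proof.
apply: lipschitz_continuous => y z; rewrite [d y z]d_sym.
exact: d_triangle.
Qed.

(** The two auxiliary infima of the proof are 1-Lipschitz because moving the
    point by [d x y] costs at most that much to every competitor. *)
Lemma inf_lipschitz_continuous (S : X -> set R) :
  (forall x, S x !=set0) -> (forall x, lbound (S x) 0) ->
  (forall x y a, S x a -> exists2 b, S y b & b <= a + d x y) ->
  continuous (fun x => inf (S x)).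
Proof.
move=> S0 Sge0 Sd; apply: lipschitz_continuous => x y.
rewrite -lerBlDr; apply: lb_le_inf => // a Sya.
have [b Sxb ba] := Sd y x a Sya.
rewrite lerBlDr [d x y]d_sym (le_trans _ ba)//.
by apply: ge_inf => //; exists 0.
Qed.

Variable A : set X.
Hypothesis gapA : positive_gap R A.

(** If [u] had no cluster point in [A], the function
    [inf_n (d x (u n) + 1 / (n + 1))] would be positive on [A], yet it is at most
    [1 / (n + 1)] at [u n].  The second summand keeps the infimum positive at
    points visited finitely often by [u]. *)
Lemma gap_cluster_seq (u : nat -> X) : (forall n, A (u n)) ->
  exists2 x, A x &
    forall (e : R) N, 0 < e -> exists2 n, (N <= n)%N & d x (u n) < e.
Proof.
move=> Au; apply: contrapT => ncl.
pose S x := range (fun n => d x (u n) + n.+1%:R^-1).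
have Sge0 x : lbound (S x) 0.
  by move=> _ [n _ <-]; rewrite addr_ge0// ?invr_ge0//; exact: d_ge0.
have S0 x : S x !=set0 by exists (d x (u 0) + 1^-1); exists 0.
have cS : continuous (fun x => inf (S x)).
  apply: inf_lipschitz_continuous => // x y _ [n _ <-].
  exists (d y (u n) + n.+1%:R^-1); first by exists n.
  rewrite addrAC lerD2r addrC [d x y]d_sym.
  exact: d_triangle.
have [x Ax|e e0 Se] := gapA cS.
  have /existsNP[e /existsNP[N /not_implyP[e0 nN]]] :
      ~ forall (e : R) N, 0 < e -> exists2 n, (N <= n)%N & d x (u n) < e.
    by move=> h; apply: ncl; exists x.
  (* From rank [N] on the distance is at least [e]; before, the summand
     [1 / (n + 1)] is at least [1 / (N + 1)]. *)
  apply: (@lt_le_trans _ _ (Num.min e N.+1%:R^-1)).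
    by rewrite lt_min e0 invr_gt0/=.
  apply: lb_le_inf => // _ [n _ <-]; rewrite ge_min.
  have [Nn|nN'] := leqP N n.
    apply/orP; left; rewrite (@le_trans _ _ (d x (u n)))//.
      by rewrite leNgt; apply/negP => xe; apply: nN; exists n.
    by rewrite lerDl invr_ge0.
  apply/orP; right; rewrite (@le_trans _ _ n.+1%:R^-1)//.
    by rewrite lef_pV2 ?posrE// ler_nat ltnS ltnW.
  by rewrite lerDr; exact: d_ge0.
have [n] := ltr_add_invr e0; rewrite add0r ltNge => /negP; apply.
rewrite (le_trans (Se _ (Au n)))//; apply: ge_inf; first by exists 0.
by exists n => //; rewrite dxx add0r.
Qed.

Hypothesis tychX : tychonoff_space X.

(** Complete regularity turns [U] into a function [f] with [f x = 0] and [f = 1]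
    off [U]; then [d x y + |1 - f y|] equals [d x y] off [U] and vanishes
    nowhere, as [d x y = 0] forces [y = x] and [f y = 0]. *)
Lemma gap_nbhs_metric (x : X) (U : set X) : nbhs x U ->
  exists2 e : R, 0 < e & forall y, A y -> d x y < e -> U y.
Proof.
move=> xU.
have [|f [cf _ fx fU]] :=
  (@uniform_separatorP X R _ _).1
    (tychX.1 x (~` U°) (open_closedC (@open_interior _ U)) _).
  by move=> /=; exact.
have ch : continuous (fun y => d x y + `|1 - f y|).
  move=> y; apply: cvgD; first exact: mdist_continuous.
  by apply: cvg_norm; apply: cvgB; [exact: cvg_cst|exact: cf].
have [y Ay|e e0 he] := gapA ch.
  have [->|xy] := eqVneq y x.
    have -> : f x = 0 by apply: fx; exists x.
    rewrite subr0 normr1 ltr_wpDl//; exact: d_ge0.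
  rewrite ltr_pwDl// (@mdist_gt0 _ M).
  by apply/eqP => yx; rewrite yx eqxx in xy.
exists e => // y Ay dxy; apply: contrapT => nUy.
have := he y Ay; have -> : f y = 1.
  by apply: fU; exists y => //; apply: contra_not nUy; exact: interior_subset.
by rewrite subrr normr0 addr0 leNgt dxy.
Qed.

(** The function [inf (S x)] measures how far the ultrafilter [F] stays from [x];
    the competitor 1 makes the infimum one of a nonempty set.  The positive gap
    acts as a Lebesgue number: balls of half that radius are not in [F], so their
    complements are, and a point of [A] far from finitely many given ones always
    exists. *)
Lemma gap_compact : compact A.
Proof.
rewrite compact_ultra => F FU FA; apply: contrapT => nF.
pose S x := [set e : R | 0 < e /\ (e = 1 \/ F [set y | d x y < e])].
have Sge0 x : lbound (S x) 0 by move=> e [/ltW].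
have S0 x : S x !=set0 by exists 1; split=> //; left.
have cS : continuous (fun x => inf (S x)).
  apply: inf_lipschitz_continuous => // x y a [a0 [->|Fa]].
    exists 1; first by split => //; left.
    by rewrite lerDl; exact: d_ge0.
  exists (a + d x y) => //; split.
    by rewrite ltr_pwDl//; exact: d_ge0.
  right; apply: filterS Fa => z /= dxz; rewrite addrC.
  rewrite (le_lt_trans (d_triangle y x z))// [d y x]d_sym.
  by rewrite ltrD2l.
have [x Ax|e e0 Se] := gapA cS.
  rewrite lt_neqAle lb_le_inf// andbT eq_sym; apply/eqP => S0x; apply: nF.
  exists x; split=> //= U /gap_nbhs_metric[e e0 eU].
  have [|a [a0 aS] ae] := @inf_lt _ (S x) (Num.min e 1) (S0 x).
    by rewrite S0x lt_min e0 ltr01.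
  move: ae; rewrite lt_min => /andP[ae a1].
  case: aS => [a1'|Fa]; first by rewrite a1' ltxx in a1.
  apply: filterS (filterI FA Fa) => y [Ay /= xy]; apply: eU => //.
  exact: lt_trans ae.
(* Every set of [F] is nonempty, and the points of [A] at distance at least
   [e / 2] from all members of [s] form a set of [F]. *)
have far (s : seq X) : {in s, forall x, A x} ->
    exists y, A y /\ {in s, forall x, e / 2 <= d x y}.
  move=> sA; suff : F [set y | A y /\ {in s, forall x, e / 2 <= d x y}].
    by move=> /filter_ex.
  apply: filterI => //; elim: s sA => [|x s IH] sA.
    by apply: filterS filterT => y _ x; rewrite in_nil.
  have Fs : F [set y | {in s, forall x, e / 2 <= d x y}].
    by apply: IH => y ys; apply: sA; rewrite inE ys orbT.
  have Fx : F [set y | e / 2 <= d x y].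
    have [Fx|Fx] := in_ultra_setVsetC [set y | d x y < e / 2] FU.
      have /Se : A x by apply: sA; exact: mem_head.
      rewrite leNgt => /negP; case; apply: (@le_lt_trans _ _ (e / 2)).
        apply: ge_inf; first by exists 0.
        by split; [rewrite divr_gt0|right].
      by rewrite ltr_pdivrMr// ltr_pMr// ltr1n.
    by apply: filterS Fx => y /= /negP; rewrite -leNgt.
  apply: filterS (filterI Fx Fs) => y [/= xy sy] z; rewrite inE.
  by move=> /orP[/eqP->//|]; exact: sy.
have [u uA usep] : exists2 u : nat -> X, forall n, A (u n) &
    forall n k, (k < n)%N -> e / 2 <= d (u k) (u n).
  (* The recursion carries the list of all points chosen so far. *)
  pose inA (s : seq X) := {in s, forall x, A x}.
  pose T := sig inA.
  have /choice[next nextP] (s : T) :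
      exists y, A y /\ {in sval s, forall x, e / 2 <= d x y}.
    by case: s => s sA; exact: far.
  have nextT (s : T) : inA (next s :: sval s).
    move=> x; rewrite inE => /orP[/eqP->|]; first exact: (nextP s).1.
    exact: (svalP s).
  have nilT : inA [::] by [].
  pose w n : T := iter n (fun s => exist inA _ (nextT s)) (exist inA _ nilT).
  exists (fun n => next (w n)) => [n|n k kn]; first exact: (nextP _).1.
  apply: (nextP (w n)).2; elim: n kn => // n IH.
  rewrite ltnS leq_eqVlt inE => /orP[/eqP->|/IH ->]; first by rewrite eqxx.
  by rewrite orbT.
have [x Ax xu] := gap_cluster_seq uA.
have e40 : 0 < e / 2 / 2 by rewrite !divr_gt0.
have [k _ xk] := xu _ 0%N e40.
have [n kn xn] := xu _ k.+1 e40.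
have := usep _ _ kn; rewrite leNgt => /negP; apply.
rewrite (le_lt_trans (d_triangle (u k) x (u n)))//.
by rewrite [d (u k) x]d_sym [ltRHS]splitr ltrD.
Qed.

(** The subsequence is extracted from the real sequence of the distances to a
    cluster point, which clusters at 0; [gap_nbhs_metric] then turns metric
    convergence into convergence in [X]. *)
Lemma gap_sequentially_compact : sequentially_compact A.
Proof.
move=> u uA; have [x Ax xu] := gap_cluster_seq uA.
have /cluster_eventually_cvg[phi phi_incr phi0] :
    cluster ((fun n => d x (u n)) @ \oo) 0.
  apply/cluster_eventuallyP => e N e0; have [n Nn xn] := xu e N e0.
  by exists n => //; rewrite sub0r normrN ger0_norm ?d_ge0// ltW.
exists phi => //; exists x => // U /gap_nbhs_metric[e e0 eU].
have /cvgrPdist_lt/(_ e e0) := phi0; apply: filterS => n /=.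
rewrite sub0r normrN ger0_norm; last exact: d_ge0.
by apply: eU.
Qed.

(** One half of the equality of topologies is that the metric is coarser, the
    other is [gap_nbhs_metric]. *)
Lemma gap_metrizable : metrizable R A.
Proof.
exists (Metric.class (submetric m A)); apply/seteqP; split=> U.
  rewrite /metric_open openE => UU; rewrite openE => x.
  move=> /UU /nbhs_ballP[e /= e0 eU].
  exists (set_val @^-1` [set y | d (set_val x) y < e]°).
    split.
      by exists ([set y | d (set_val x) y < e]°) => //; exact: open_interior.
    exact: (coarser_nbhs (set_val x) e0).
  by move=> y /= /interior_subset /= xy; apply: eU; rewrite ballEmdist.
rewrite openE => UU; rewrite /metric_open openE => x /UU.
move=> [_ [/= [V oV <-] Vx] VU].
have [e e0 eV] : exists2 e : R, 0 < e &
    forall y, A y -> d (set_val x) y < e -> V y.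
  by apply: gap_nbhs_metric; exact: open_nbhs_nbhs.
apply/nbhs_ballP; exists e => // y; rewrite ballEmdist /= => xy.
by apply: VU; apply: eV => //; exact: set_valP.
Qed.

End Coarser_metric.

(** * From compactness to the other properties *)

(** A point of [A] serves as the base point that [compact_cover] asks for. *)
Lemma compact_countably_compact (X : topologicalType) (A : set X) :
  A !=set0 -> compact A -> countably_compact A.
Proof.
move=> [x _] cA I D f _.
pose pX : ptopologicalType := HB.pack (X : Type) X (isPointed.Build X x).
have : @cover_compact pX A by rewrite -compact_cover.
by move=> /(_ I D f).
Qed.

Lemma compact_pseudocompact (R : realType) (X : topologicalType) (A : set X) :
  compact A -> pseudocompact R A.
Proof.
move=> cA f; have /continuous_compact/(_ cA)/compact_bounded :
    {within A, continuous (valL (f : A -> R))}.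
  by apply/subspace_valL_continuousP; exact: cts_fun.
apply: sub_boundedr => B B_valL _ [x _ <-]; apply: B_valL.
by exists (set_val x); [exact: set_valP|rewrite -[in RHS](valLK point f)].
Qed.

(** * Coincidence of the six families *)

Lemma submetrizable_gap_families (R : realType) (X : topologicalType)
    (A : set X) : submetrizable R X -> tychonoff_space X -> A !=set0 ->
  [/\ metrizable_compact R A <-> positive_gap R A,
      compact A <-> positive_gap R A,
      sequentially_compact A <-> positive_gap R A &
      [/\ countably_compact A <-> positive_gap R A,
      pseudocompact R A <-> positive_gap R A &
      C_compact R A <-> positive_gap R A]].
Proof.
move=> [m mX] tychX A0.
have gc : positive_gap R A -> compact A.
  by move=> gA; exact: gap_compact mX _ gA _.
have cg : compact A -> positive_gap R A.
  by move=> cA; exact/C_compact_gap/compact_C_compact.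
split.
- split=> [[/cg]//|gA]; split; first exact: gc.
  exact: gap_metrizable mX _ gA _.
- by split.
- split=> [/sequentially_compact_gap //|gA].
  exact: gap_sequentially_compact mX _ gA _.
split.
- split=> [/countably_compact_gap //|/gc]; exact: compact_countably_compact.
- split=> [/pseudocompact_gap //|/gc]; exact: compact_pseudocompact.
- split=> [/C_compact_gap //|/gc]; exact: compact_C_compact.
Qed.

Theorem theorem4p14 (R : realType) (X : topologicalType)
  (submX : submetrizable R X) (tychX : tychonoff_space X) :
  [/\ Ck R X = Cc R X, Cc R X = Csc R X, Csc R X = Ccc R X,
      Ccc R X = Cps R X & Cps R X = Crc R X].
Proof.
have fam P : (forall A : set X, A !=set0 -> P A <-> positive_gap R A) ->
    nonempty_sets P = nonempty_sets (@positive_gap R X).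
  move=> PE; apply/seteqP.
  by split=> A [A0 PA]; split=> //; apply/(PE A A0).
have famE A := @submetrizable_gap_families R X A submX tychX.
rewrite /Ck /Cc /Csc /Ccc /Cps /Crc.
by rewrite !fam// => A /famE[? ? ? []].
Qed.
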